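(* There exists a universal constant $C_{\mathsf{ub}}>0$ such that, for every $\mu$ satisfying the standing assumptions, with $\nu=\mu$, and every $\varepsilon>0$, $$\sup_{(x,y)\in\operatorname{spt}\pi_\varepsilon}\|x-y\|\le C_{\mathsf{ub}}\min\big(\delta_{\mathsf{ST}}^{1/2}(\varepsilon),\operatorname{diam}(\operatorname{spt}\mu)\big),$$ where $$\delta_{\mathsf{ST}}(\varepsilon):=\inf\{r>0: r\cdot\rho(\sqrt r)>\varepsilon\},\qquad \rho(r):=\inf_{x\in\operatorname{spt}\mu}\mu(B(x,r)).$$ Consequently, $$\operatorname{dist}(\operatorname{spt}\pi_\varepsilon;\operatorname{spt}\pi_\star)\le C_{\mathsf{ub}}\min\big(\delta_{\mathsf{ST}}^{1/2}(\varepsilon),\operatorname{diam}(\operatorname{spt}\mu)\big).$$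
   Context: Work in $\mathbb R^d$, $d\in\mathbb N$, with Euclidean norm; $B(x,r)$ is the open ball and $\operatorname{diam}(A)=\sup_{x,y\in A}\|x-y\|$. Standing assumptions: $\mu$ is a Borel probability measure on $\mathbb R^d$, absolutely continuous with respect to Lebesgue measure, $\operatorname{spt}\mu\subseteq B(0,1)$, and the interior of $\operatorname{spt}\mu$ is connected. Self-transport setting: $\nu=\mu$. Put $c(x,y)=\tfrac12\|x-y\|^2$ and $\mathbb P=\mu\otimes\nu$ (so $\operatorname{spt}\mathbb P=\operatorname{spt}\mu\times\operatorname{spt}\nu$). Quadratically regularized optimal transport: for $\varepsilon>0$, $\pi_\varepsilon$ is the unique minimizer over couplings $\pi$ of $\mu$ and $\nu$ of $\int c\,d\pi+\frac{\varepsilon}{2}\|\frac{d\pi}{d\mathbb P}\|^2_{L^2(\mathbb P)}$. It has density $\frac{d\pi_\varepsilon}{d\mathbb P}(x,y)=\frac1\varepsilon[f_\varepsilon(x)+g_\varepsilon(y)-c(x,y)]_+$, where the optimal dual potentials $f_\varepsilon,g_\varepsilon:\mathbb R^d\to\mathbb R$ are continuous and determined, up to a constant shift $(f_\varepsilon+a,g_\varepsilon-a)$, by $$\int[f_\varepsilon(x)+g_\varepsilon(y)-c(x,y)]_+\,\mu(dx)=\varepsilon\ \ \forall y\in\mathbb R^d,\qquad \int[f_\varepsilon(x)+g_\varepsilon(y)-c(x,y)]_+\,\nu(dy)=\varepsilon\ \ \forall x\in\mathbb R^d.$$ The support of $\pi_\varepsilon$ is $\operatorname{spt}\pi_\varepsilon:=\overline{\{(x,y)\in\operatorname{spt}\mathbb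 P: f_\varepsilon(x)+g_\varepsilon(y)>c(x,y)\}}$. The unregularized optimal coupling $\pi_\star$ (minimizer of $\int c\,d\pi$ over couplings of $\mu$ and $\nu=\mu$) has $\operatorname{spt}\pi_\star=\{(x,x):x\in\operatorname{spt}\mu\}$. For $A,B\subseteq\mathbb R^d\times\mathbb R^d$, $\operatorname{dist}(A;B):=\sup_{a\in A}\inf_{b\in B}\|a-b\|$ (Euclidean norm on $\mathbb R^d\times\mathbb R^d$). *)

(* Defs.v *)
From HB Require Import structures.
From mathcomp Require Import all_boot all_order all_algebra.
From mathcomp Require Import all_classical all_reals all_analysis.

Set Implicit Arguments.
Unset Strict Implicit.
Unset Printing Implicit Defensive.
Import Order.TTheory GRing.Theory Num.Theory.
Import numFieldNormedType.Exports.
Local Open Scope classical_set_scope.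
Local Open Scope ring_scope.

(* R^d is 'rV[R]_d with the library topology; it gets the Borel sigma-algebra,
   and 'rV[R]_d * 'rV[R]_d the library's product sigma-algebra. *)
Section Borel.
Context (R : realType) (d : nat).

Definition borel_rV : set (set 'rV[R]_d) := <<s @open 'rV[R]_d >>.

HB.instance Definition _ :=
  @isMeasurable.Build (sigma_display (@open 'rV[R]_d)) 'rV[R]_d borel_rV
    (@sigma_algebra0 _ setT (@open 'rV[R]_d))
    (@sigma_algebraC 'rV[R]_d (@open 'rV[R]_d))
    (@sigma_algebra_bigcup _ setT (@open 'rV[R]_d)).

End Borel.

Section Euclidean.
Context {R : realType} {d : nat}.
Implicit Types (x y : 'rV[R]_d) (A : set 'rV[R]_d).

(* The library norm `|x| on 'rV[R]_d is the sup norm, hence this definition. *)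
Definition enorm x : R := Num.sqrt (\sum_(i < d) x ord0 i ^+ 2).

Definition eball x (r : R) : set 'rV[R]_d := [set y | enorm (y - x) < r].

Definition ediam A : R := sup [set enorm (x - y) | x in A & y in A].

Definition enorm2 (z : 'rV[R]_d * 'rV[R]_d) : R :=
  Num.sqrt (enorm z.1 ^+ 2 + enorm z.2 ^+ 2).

(* One-sided; ereal_sup and ereal_inf make it correct for all sets. *)
Definition dist (A B : set ('rV[R]_d * 'rV[R]_d)) : \bar R :=
  ereal_sup [set ereal_inf [set (enorm2 (a - b))%:E | b in B] | a in A].

Definition box x y : set 'rV[R]_d :=
  [set z | forall i, x ord0 i < z ord0 i <= y ord0 i].

(* d-dimensional Lebesgue (outer) measure: infimum over countable covers by
   boxes of the total volume (for 0 < d). *)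
Definition lebesgue_outer A : \bar R :=
  ereal_inf [set (\sum_(k <oo) (\prod_(i < d) (ab.2 k ord0 i - ab.1 k ord0 i))%:E)%E
    | ab in [set ab : (nat -> 'rV[R]_d) * (nat -> 'rV[R]_d) |
        (forall k i, ab.1 k ord0 i <= ab.2 k ord0 i) /\
        A `<=` \bigcup_k box (ab.1 k) (ab.2 k)]].

End Euclidean.

Definition spt {R : realType} {T : topologicalType} (m : set T -> \bar R) :
    set T :=
  [set x | forall U, open U -> U x -> (0 < m U)%E].

Section Transport.
Context {R : realType} {d : nat}.
Notation E := 'rV[R]_d.
Implicit Types (mu nu : probability E R) (pi : probability (E * E)%type R).
Implicit Types (f g : E -> R) (eps : R).

Definition standing_assumptions mu : Prop :=
  [/\ (forall A, measurable A -> lebesgue_outer A = 0%E -> mu A = 0%E),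
      spt mu `<=` eball 0 1 &
      connected (interior (spt mu))].

Definition cost (z : E * E) : R := enorm (z.1 - z.2) ^+ 2 / 2.

Definition coupling mu nu pi : Prop :=
  (forall A, measurable A -> pi (A `*` setT) = mu A) /\
  (forall B, measurable B -> pi (setT `*` B) = nu B).

Definition transport_cost pi : \bar R := (\int[pi]_z (cost z)%:E)%E.

Definition ot_plan mu nu pi : Prop :=
  coupling mu nu pi /\
  forall pi', coupling mu nu pi' -> (transport_cost pi <= transport_cost pi')%E.

(* || d pi / d P ||^2 in L^2(P), with value +oo when pi is not absolutely
   continuous with respect to P. *)
Definition sqnorm_density (P pi : probability (E * E)%type R) : \bar R :=
  if pselect (pi `<< P) then
    (\int[P]_z Radon_Nikodym (charge_of_finite_measure pi) P z ^+ 2)%E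
  else +oo%E.

Definition qot_objective mu nu eps pi : \bar R :=
  (transport_cost pi + (eps / 2)%:E * sqnorm_density (mu \x nu) pi)%E.

Definition qot_plan mu nu eps pi : Prop :=
  coupling mu nu pi /\
  forall pi', coupling mu nu pi' ->
    (qot_objective mu nu eps pi <= qot_objective mu nu eps pi')%E.

(* Positive part of f + g - c; eps^-1 times it is the density of the optimal
   regularized coupling with respect to mu \x nu. *)
Definition slack f g (z : E * E) : R := Num.max 0 (f z.1 + g z.2 - cost z).

Definition qot_potentials mu nu eps f g : Prop :=
  [/\ continuous f,
      continuous g,
      forall y, (\int[mu]_x (slack f g (x, y))%:E)%E = eps%:E &
      forall x, (\int[nu]_y (slack f g (x, y))%:E)%E = eps%:E].

Definition qot_density mu nu eps f g pi : Prop :=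
  forall A, measurable A ->
    pi A = (\int[mu \x nu]_(z in A) (eps^-1 * slack f g z)%:E)%E.

Definition spt_qot mu nu f g : set (E * E) :=
  closure [set z | spt (mu \x nu)%E z /\ cost z < f z.1 + g z.2].

Definition rho mu (r : R) : \bar R := ereal_inf [set mu (eball x r) | x in spt mu].

(* The set is bounded below by 0 and contains every r > max(4, eps) when
   spt mu is included in the unit ball, so that inf is the true infimum. *)
Definition delta_ST mu eps : R :=
  inf [set r | 0 < r /\ (eps%:E < r%:E * rho mu (Num.sqrt r))%E].

Definition ub_rate mu eps : R :=
  Num.min (Num.sqrt (delta_ST mu eps)) (ediam (spt mu)).

End Transport.

(* Main.v *)
Require Import Defs.
From mathcomp Require Import all_boot all_order all_algebra.
From mathcomp Require Import all_classical all_reals all_analysis.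
From mathcomp Require Import measurable_realfun ring lra.
Import Order.TTheory GRing.Theory Num.Theory.
Import numFieldNormedType.Exports.
Local Open Scope classical_set_scope.
Local Open Scope ring_scope.

(** Why the theorem holds.  Write [K] for the support of [mu] and [c] for the
    cost [|x - y|^2 / 2].

    Symmetrization.  Since [mu = nu] and [c] is symmetric, [(g, f)] solves the
    same equations as [(f, g)].  Put [a(x, y) = (f(x) + g(y) - c(x, y))_+],
    [b(x, y) = (g(x) + f(y) - c(x, y))_+] and let [w] be an increasing function
    of [f - g].  Both [a] and [b] have all their marginal integrals equal to
    [eps], so [(a - b)(w(x) - w(y))] integrates to [0] against [mu \x mu]; it is
    nonnegative because the arguments of the two positive parts differ by
    [(f - g)(x) - (f - g)(y)].  Hence it vanishes on [K * K], and [a = b] there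
    ([slack_symmetric]).  It follows that the single function [h = (f + g) / 2]
    can replace both potentials on [K * K] ([slack_mean]).  This does not make
    [f - g] constant, which may fail when [K] has several clusters.

    Size of the peak.  Let [x0] maximize [h] over [K] and [M = h(x0) > 0].
    Pairs active at [y] lie at squared distance at most of order [M], so moving
    [y] away from [x0] by [sqrt M / 5] changes the cost of active pairs by at
    most [M / 2]; the marginal equations at [y] and [x0] then force
    [h(y) >= M / 2] ([peak_half]).  So the integrand of the equation at [x0] is
    at least [M] on the ball of radius [sqrt (M / 25)], which gives
    [M mu(B(x0, sqrt r)) <= eps] for [r <= M / 25] ([peak_ball_mass]) and
    [M / 25 <= delta_ST mu eps] ([peak_le_delta]).

    Conclusion.  On an active pair, [c(x, y) < h(x) + h(y) <= 2 M], whence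
    [|x - y|^2 <= 4 M <= 100 delta_ST mu eps]: the constant is [10].  The bound
    by the diameter holds since active pairs lie in [K * K], and both survive
    taking the closure.  For the second claim, the coupling carried by the
    diagonal has cost [0], so an optimal plan gives no mass to [c <> 0] and its
    support contains [(x, x)] for every [x] in [K]; this point is at distance
    [|x - y|] from [(x, y)]. *)

(** * Borel sets, supports and null sets *)

Section borel.
Context {R : realType} {d : nat}.
Local Notation E := 'rV[R]_d.

Lemma rational_ball (x : E) (e : R) : 0 < e ->
  exists (q : 'rV[rat]_d) (r : rat),
    [/\ 0 < ratr r :> R, ball (map_mx ratr q : E) (ratr r) x &
        ball (map_mx ratr q : E) (ratr r) `<=` ball x e].
Proof.
move=> e0.
have [r] : exists r : rat, (ratr r : R) \in `]0, e / 2[.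
  by apply/rat_in_itvoo; rewrite divr_gt0.
rewrite in_itv/= => /andP[r0 re].
have /choice[q qP] : forall i, exists q : rat, `|ratr q - x ord0 i| < ratr r.
  move=> i.
  have [q] := @rat_in_itvoo R (x ord0 i - ratr r) (x ord0 i + ratr r) ltac:(lra).
  rewrite in_itv/= => /andP[? ?]; exists q.
  by rewrite ltr_norml; apply/andP; split; lra.
have qx : ball (map_mx ratr (\row_i q i) : E) (ratr r) x.
  by split=> // i j; rewrite !mxE (ord1 i); exact: qP.
exists (\row_i q i), r; split=> // y qy.
rewrite [e]splitr; apply: (@ball_triangle _ _ (map_mx ratr (\row_i q i) : E)).
  by apply: le_ball (ball_sym qx); lra.
by apply: le_ball qy; lra.
Qed.

(** Second countability, as a sequence: it makes open sets of the product
    measurable for the product sigma-algebra, and the union of all null open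
    sets null. *)
Lemma countable_open_base : exists B : nat -> set E,
  (forall n, open (B n)) /\
  forall U x, open U -> U x -> exists n, B n x /\ B n `<=` U.
Proof.
pose B n : set E := 
  if (unpickle n : option ('rV[rat]_d * rat)) is Some qr
  then interior (ball (map_mx ratr qr.1 : E) (ratr qr.2)) else set0.
exists B; split=> [n|U x oU Ux].
  by rewrite /B; case: unpickle => [qr|]; [exact: open_interior|exact: open0].
have /nbhs_ballP[e /= e0 eU] : nbhs x U by exact: open_nbhs_nbhs.
have [q [r [r0 qx qe]]] := rational_ball x e e0.
exists (pickle (q, r)); rewrite /B pickleK; split.
  have : open_nbhs x (ball (map_mx ratr q : E) (ratr r)).
    by split => //; exact: ball_open.
  exact: open_nbhs_nbhs.
by apply: subset_trans eU; apply: subset_trans qe; exact: interior_subset.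
Qed.

Lemma open_measurable_rV (U : set E) : open U -> measurable U.
Proof. by move=> oU; exact: sub_sigma_algebra. Qed.

(** The product sigma-algebra is generated by rectangles only, so the
    countable base is essential. *)
Lemma open_measurable_prod (U : set (E * E)) : open U -> measurable U.
Proof.
move=> oU; have [B [oB baseB]] := countable_open_base.
have -> : U = \bigcup_n \bigcup_(m in [set m | B n `*` B m `<=` U]) (B n `*` B m).
  apply/seteqP; split=> [[x y] Uxy|z [n _ [m Um] Bz]]; last exact: Um.
  have : nbhs (x, y) U by exact: open_nbhs_nbhs.
  move=> [[V W] /= [+ +] VWU].
  rewrite 2!nbhsE => -[V' [oV' V'x] V'V] [W' [oW' W'y] W'W].
  have [n [nx nV]] := baseB _ _ oV' V'x.
  have [m [my mW]] := baseB _ _ oW' W'y.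
  exists n => //; exists m => //= z [/nV/V'V z1 /mW/W'W z2].
  exact: VWU.
apply: bigcup_measurable => n _; apply: bigcup_measurable => m _.
by apply: measurableX; exact: open_measurable_rV.
Qed.

Lemma continuous_measurable_rV (f : E -> R) :
  continuous f -> measurable_fun setT f.
Proof.
move=> /continuousP cf; apply: (measurability _ (RGenOpens.measurableE R)).
move=> _ [_ [a [b ->]] <-]; rewrite setTI; apply: open_measurable_rV.
by apply: cf; exact: interval_open.
Qed.

Lemma continuous_measurable_prod (f : E * E -> R) :
  continuous f -> measurable_fun setT f.
Proof.
move=> /continuousP cf; apply: (measurability _ (RGenOpens.measurableE R)).
move=> _ [_ [a [b ->]] <-]; rewrite setTI; apply: open_measurable_prod.
by apply: cf; exact: interval_open.
Qed.

Lemma spt_closed {T : topologicalType} (m : set T -> \bar R) : closed (spt m).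
Proof.
move=> x clx U oU Ux.
by have [y [my Uy]] := clx U (open_nbhs_nbhs (conj oU Ux)); exact: my.
Qed.

(** The complement of the support is a union of null open sets, which can
    be taken among the countably many basic ones. *)
Lemma spt_complement_null (mu : probability E R) : mu (~` spt mu) = 0%E.
Proof.
have [B [oB baseB]] := countable_open_base.
have mspt : measurable (~` spt mu).
  by apply: open_measurable_rV; rewrite openC; exact: spt_closed.
apply/(@negligibleP _ _ _ mu _ mspt).
pose F n := if mu (B n) == 0%E then B n else set0.
apply: (@negligibleS _ _ _ _ (\bigcup_n F n)).
  move=> x /existsNP[U] /not_implyP[oU] /not_implyP[Ux] /negP.
  rewrite -leNgt => muU.
  have [n [nx nU]] := baseB _ _ oU Ux.
  exists n => //; rewrite /F ifT// -measure_le0 (le_trans _ muU)//.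
  by rewrite le_measure// ?inE; exact: open_measurable_rV.
apply: negligible_bigcup => n; rewrite /F; case: ifPn => [/eqP Bn0|_].
  by apply/negligibleP => //; exact: open_measurable_rV.
exact: negligible_set0.
Qed.

Lemma spt_product (mu nu : probability E R) :
  spt (mu \x nu)%E = spt mu `*` spt nu.
Proof.
apply/seteqP; split=> [[x y] xy|[x y] /= [mux nuy] U oU Uxy].
  split=> /= U oU Uz.
    have /xy : open (U `*` [set: E]).
      have -> : U `*` [set: E] = fst @^-1` U by apply/seteqP; split=> z //= [].
      by apply: open_comp => // z _; exact: cvg_fst.
    have -> : mu U = (mu \x nu)%E (U `*` [set: E]).
      rewrite product_measure1E//; last exact: open_measurable_rV.
      by rewrite [X in (_ * X)%E](probability_setT nu) mule1.
    by apply.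
  have /xy : open ([set: E] `*` U).
    have -> : [set: E] `*` U = snd @^-1` U by apply/seteqP; split=> z //= [].
    by apply: open_comp => // z _; exact: cvg_snd.
  have -> : nu U = (mu \x nu)%E ([set: E] `*` U).
    rewrite product_measure1E//; last exact: open_measurable_rV.
    by rewrite [X in (X * _)%E](probability_setT mu) mul1e.
  by apply.
have : nbhs (x, y) U by exact: open_nbhs_nbhs.
move=> [[V W] /= [+ +] VWU].
rewrite 2!nbhsE => -[V' [oV' V'x] V'V] [W' [oW' W'y] W'W].
have mV := open_measurable_rV _ oV'; have mW := open_measurable_rV _ oW'.
apply: (@lt_le_trans _ _ ((mu \x nu)%E (V' `*` W'))); last first.
  rewrite le_measure// ?inE; [exact: measurableX|exact: open_measurable_prod|].
  by move=> z [/V'V ? /W'W ?]; exact: VWU.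
by rewrite product_measure1E// mule_gt0//; [exact: mux|exact: nuy].
Qed.

Lemma integral0_null (m : probability (E * E)%type R) (H : E * E -> R) :
  continuous H -> (forall z, 0 <= H z) -> (\int[m]_z (H z)%:E)%E = 0%E ->
  m [set z | H z != 0] = 0%E.
Proof.
move=> cH H0 iH.
have oH : open [set z | H z != 0].
  exact: (@open_comp _ _ H [set t | t != 0]) (fun z _ => cH z) (@open_neq _ 0).
apply/negligibleP; first exact: open_measurable_prod.
have mH : measurable_fun [set: (E * E)%type] (fun z => (H z)%:E).
  by apply/measurable_EFinP; exact: continuous_measurable_prod.
have : (\int[m]_z `|(H z)%:E| = 0)%E.
  by rewrite -iH; apply: eq_integral => z _; rewrite /= ger0_norm.
move/(ae_eq_integral_abs m measurableT mH).
by apply: negligibleS => z /= Hz /(_ I) [] /eqP; exact/negP.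
Qed.

End borel.

(** * Euclidean norm, cost and slack *)

Section euclidean.
Context {R : realType} {d : nat}.
Local Notation E := 'rV[R]_d.
Implicit Types x y : E.

Lemma enorm_ge0 x : 0 <= enorm x.
Proof. exact: sqrtr_ge0. Qed.

Lemma enorm_sqr x : enorm x ^+ 2 = \sum_(i < d) x ord0 i ^+ 2.
Proof. by rewrite sqr_sqrtr// sumr_ge0// => i _; exact: sqr_ge0. Qed.

Lemma enormB x y : enorm (x - y) = enorm (y - x).
Proof. by congr Num.sqrt; apply: eq_bigr => i _; rewrite !mxE; ring. Qed.

Lemma enorm_ltE x (r : R) : 0 <= r -> (enorm x < r) = (enorm x ^+ 2 < r ^+ 2).
Proof. by move=> r0; rewrite ltr_pXn2r// ?nnegrE ?enorm_ge0. Qed.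

(** Young's inequality in each coordinate.  It replaces the Cauchy-Schwarz
    inequality wherever a cost has to be moved from one base point to another. *)
Lemma enorm_sqr_triangle (t : R) x y z : 0 < t ->
  enorm (x - z) ^+ 2 <=
  (1 + t) * enorm (x - y) ^+ 2 + (1 + t^-1) * enorm (y - z) ^+ 2.
Proof.
move=> t0; rewrite !enorm_sqr !mulr_sumr -big_split/=.
apply: ler_sum => i _; rewrite !mxE.
set a := x ord0 i; set b := y ord0 i; set c := z ord0 i.
rewrite -subr_ge0 (_ : _ - _ = t^-1 * (t * (a - b) - (b - c)) ^+ 2).
  by rewrite mulr_ge0 ?sqr_ge0// invr_ge0 ltW.
by field; rewrite gt_eqF.
Qed.

Lemma enorm_continuous : continuous (@enorm R d).
Proof.
move=> x; apply: (@continuous_comp _ _ _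
  (fun y : E => \sum_(i < d) y ord0 i ^+ 2) Num.sqrt); last exact: sqrt_continuous.
apply: continuous_big => [|i _ y]; first exact: add_continuous.
apply: (@continuous_comp _ _ _ (fun y : E => y ord0 i) (fun t => t ^+ 2)).
  exact: coord_continuous.
exact: exprn_continuous.
Qed.

Lemma enormB_continuous : continuous (fun z : E * E => enorm (z.1 - z.2)).
Proof.
move=> z; apply: (@continuous_comp _ _ _ (fun z : E * E => z.1 - z.2) enorm).
  by apply: cvgB; [exact: cvg_fst|exact: cvg_snd].
exact: enorm_continuous.
Qed.

Lemma cost_continuous : continuous (@cost R d).
Proof.
move=> z; apply: cvgM; last exact: cvg_cst.
by apply: cvgM; exact: enormB_continuous.
Qed.

Lemma cost_ge0 (z : E * E) : 0 <= cost z.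
Proof. by rewrite divr_ge0// sqr_ge0. Qed.

Lemma cost_diag x : cost (x, x) = 0.
Proof. by rewrite /cost/= enorm_sqr big1 ?mul0r// => i _; rewrite !mxE; ring. Qed.

Lemma cost_eq0 x y : cost (x, y) = 0 -> x = y.
Proof.
move=> /eqP; rewrite /cost/= mulf_eq0 invr_eq0 pnatr_eq0 orbF enorm_sqr.
rewrite psumr_eq0 => [/allP xy|i _]; last exact: sqr_ge0.
apply/rowP => i; have := xy i (mem_index_enum i).
by rewrite sqrf_eq0 !mxE subr_eq0 => /eqP.
Qed.

Lemma cost_sym x y : cost (x, y) = cost (y, x).
Proof. by rewrite /cost/= enormB. Qed.

Lemma eball_open x (r : R) : open (eball x r).
Proof.
apply: (@open_comp _ _ (fun y => enorm (y - x)) [set t | t < r]); last exact: open_lt.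
move=> y _; apply: (@continuous_comp _ _ _ (fun y : E => y - x) enorm).
  by apply: continuousB => //; exact: cst_continuous.
exact: enorm_continuous.
Qed.

Lemma unit_ball_diameter x y : eball 0 1 x -> eball 0 1 y -> enorm (x - y) <= 2.
Proof.
rewrite /eball/= !enorm_ltE// => x1 y1.
rewrite -(@ler_pXn2r _ 2%N)// ?nnegrE ?enorm_ge0//.
have := @enorm_sqr_triangle 1 x 0 y ltr01.
by rewrite invr1 (enormB 0 y); lra.
Qed.

Lemma subset_unit_ball_compact (A : set E) :
  A `<=` eball 0 1 -> closed A -> compact A.
Proof.
move=> A1; apply: bounded_closed_compact; exists 1; split=> // M M1 x /A1.
rewrite /eball/= subr0 enorm_ltE// enorm_sqr => x1.
rewrite [leLHS]mx_normrE.
apply/bigmax_leP; split=> [|[i j] _ /=]; first by rewrite ltW// (lt_trans ltr01).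
rewrite (ord1 i); apply: le_trans (ltW M1).
rewrite -(@ler_pXn2r _ 2%N)// ?nnegrE// real_normK ?num_real//.
apply: le_trans (ltW x1).
by rewrite (bigD1 j)//= lerDl sumr_ge0// => k _; exact: sqr_ge0.
Qed.

Lemma ediam_ub (A : set E) x y : A `<=` eball 0 1 -> A x -> A y ->
  enorm (x - y) <= ediam A.
Proof.
move=> A1 Ax Ay; apply: ub_le_sup; last by exists x => //; exists y.
exists 2 => _ [u /A1 u1 [v /A1 v1 <-]]; exact: unit_ball_diameter.
Qed.

Lemma slack_ge0 (f g : E -> R) z : 0 <= slack f g z.
Proof. by rewrite /slack le_max lexx. Qed.

Lemma slack_continuous (f g : E -> R) :
  continuous f -> continuous g -> continuous (slack f g).
Proof.
move=> cf cg z.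
apply: (@continuous_max _ _ (cst 0) (fun z => f z.1 + g z.2 - cost z)).
  exact: cst_continuous.
apply: continuousB; last exact: cost_continuous.
apply: continuousD.
  apply: (@continuous_comp _ _ _ fst f); [exact: cvg_fst|exact: cf].
apply: (@continuous_comp _ _ _ snd g); [exact: cvg_snd|exact: cg].
Qed.

Lemma slack_sym (f g : E -> R) x y : slack f g (x, y) = slack g f (y, x).
Proof. by rewrite /slack/= cost_sym addrC [g y + _]addrC addrC. Qed.

End euclidean.

(** * Symmetrization of the potentials *)

Section symmetrization.
Context {R : realType} {d : nat}.
Local Notation E := 'rV[R]_d.
Implicit Types (mu nu : probability E R) (f g w : E -> R) (k : E * E -> R).

Lemma measurable_weight1 k w : continuous k -> continuous w ->
  measurable_fun [set: (E * E)%type] (fun z => (k z * w z.1)%:E).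
Proof.
move=> ck cw; apply/measurable_EFinP; apply: measurable_funM.
  exact: continuous_measurable_prod.
apply: measurableT_comp; first exact: continuous_measurable_rV.
exact: measurable_fst.
Qed.

Lemma measurable_weight2 k w : continuous k -> continuous w ->
  measurable_fun [set: (E * E)%type] (fun z => (k z * w z.2)%:E).
Proof.
move=> ck cw; apply/measurable_EFinP; apply: measurable_funM.
  exact: continuous_measurable_prod.
apply: measurableT_comp; first exact: continuous_measurable_rV.
exact: measurable_snd.
Qed.

Lemma measurable_section1 k x : continuous k ->
  measurable_fun [set: E] (fun y => (k (x, y))%:E).
Proof.
move=> ck; apply/measurable_EFinP.
apply: (measurableT_comp (f := k)); first exact: continuous_measurable_prod.
exact: pair1_measurable.
Qed.

Lemma measurable_section2 k y : continuous k ->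
  measurable_fun [set: E] (fun x => (k (x, y))%:E).
Proof.
move=> ck; apply/measurable_EFinP.
apply: (measurableT_comp (f := k)); first exact: continuous_measurable_prod.
exact: pair2_measurable.
Qed.

Lemma integral_weight1 mu nu k w (eps : R) :
  continuous k -> (forall z, 0 <= k z) -> continuous w -> (forall x, 0 <= w x) ->
  (forall x, (\int[nu]_y (k (x, y))%:E)%E = eps%:E) ->
  (\int[(mu \x nu)]_z (k z * w z.1)%:E = \int[mu]_x (eps * w x)%:E)%E.
Proof.
move=> ck k0 cw w0 keps.
rewrite fubini_tonelli1; last 2 first.
- exact: measurable_weight1.
- by move=> z; rewrite lee_fin mulr_ge0.
apply: eq_integral => x _; rewrite /fubini_F/=.
under eq_integral do rewrite EFinM.
rewrite ge0_integralZr//; first by rewrite keps EFinM.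
- exact: measurable_section1.
- by move=> y _; rewrite lee_fin.
- by rewrite lee_fin.
Qed.

Lemma integral_weight2 mu nu k w (eps : R) :
  continuous k -> (forall z, 0 <= k z) -> continuous w -> (forall x, 0 <= w x) ->
  (forall y, (\int[mu]_x (k (x, y))%:E)%E = eps%:E) ->
  (\int[(mu \x nu)]_z (k z * w z.2)%:E = \int[nu]_y (eps * w y)%:E)%E.
Proof.
move=> ck k0 cw w0 keps.
rewrite fubini_tonelli2; last 2 first.
- exact: measurable_weight2.
- by move=> z; rewrite lee_fin mulr_ge0.
apply: eq_integral => y _; rewrite /fubini_G/=.
under eq_integral do rewrite EFinM.
rewrite ge0_integralZr//; first by rewrite keps EFinM.
- exact: measurable_section2.
- by move=> x _; rewrite lee_fin.
- by rewrite lee_fin.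
Qed.

(** A bounded, nonnegative, strictly increasing function of [f - g].
    Boundedness keeps the integrals below finite although [f - g] may be
    unbounded off the support, and nonnegativity lets Tonelli's theorem apply. *)
Definition gap_weight f g x : R := atan (f x - g x) + pi.

Lemma gap_weight_ge0 f g x : 0 <= gap_weight f g x.
Proof.
by have := atan_gtNpi2 (f x - g x); have := pi_gt0 R; rewrite /gap_weight; lra.
Qed.

Lemma gap_weight_le f g x : gap_weight f g x <= 2 * pi.
Proof.
by have := atan_ltpi2 (f x - g x); have := pi_gt0 R; rewrite /gap_weight; lra.
Qed.

Lemma gap_weight_continuous f g :
  continuous f -> continuous g -> continuous (gap_weight f g).
Proof.
move=> cf cg x.
apply: (@continuousD _ _ _ (fun x => atan (f x - g x)) (cst pi)); last exact: cst_continuous.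
apply: (@continuous_comp _ _ _ (f - g) (@atan R)); last exact: continuous_atan.
by apply: continuousB; [exact: cf|exact: cg].
Qed.

(** Nonnegative by monotonicity and of zero integral by the marginal
    equations: the quantity that forces the two slacks to agree. *)
Definition swap_defect f g (z : E * E) : R :=
  (slack f g z - slack g f z) * (gap_weight f g z.1 - gap_weight f g z.2).

(** The gaps [f - g] at the two points compare like the two slacks, because
    [f x + g y - (g x + f y)] is the difference of these gaps. *)
Lemma swap_defect_ge0 f g z : 0 <= swap_defect f g z.
Proof.
have [le12|/ltW le21] := lerP (f z.1 - g z.1) (f z.2 - g z.2).
  apply: mulr_le0; rewrite subr_le0.
    by rewrite /slack le_max2 ?lexx//; lra.
  by rewrite lerD2r le_atan.
apply: mulr_ge0; rewrite subr_ge0.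
  by rewrite /slack le_max2 ?lexx//; lra.
by rewrite lerD2r le_atan.
Qed.

Lemma swap_defect_eq0 f g z : swap_defect f g z = 0 -> slack f g z = slack g f z.
Proof.
move/eqP; rewrite mulf_eq0 !subr_eq0 => /orP[/eqP//|/eqP].
rewrite /gap_weight => /addIr.
have [lt12|lt21|eq12 _] := ltgtP (f z.1 - g z.1) (f z.2 - g z.2).
- by have := lt_atan lt12; lra.
- by have := lt_atan lt21; lra.
- by rewrite /slack; congr Num.max; lra.
Qed.

Lemma swap_defect_continuous f g :
  continuous f -> continuous g -> continuous (swap_defect f g).
Proof.
move=> cf cg z; have cw := gap_weight_continuous f g cf cg.
apply: (@continuousM _ _ (fun z => slack f g z - slack g f z)
                         (fun z => gap_weight f g z.1 - gap_weight f g z.2)).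
  by apply: continuousB; exact: slack_continuous.
apply: continuousB.
  by apply: (@continuous_comp _ _ _ fst (gap_weight f g)); [exact: cvg_fst|exact: cw].
by apply: (@continuous_comp _ _ _ snd (gap_weight f g)); [exact: cvg_snd|exact: cw].
Qed.

(** Expanding the product yields four integrals, which coincide because
    every marginal integral of both slacks is [eps].  The signs are handled by
    adding the two negative terms to both sides, so that every integrand is
    nonnegative. *)
Lemma integral_swap_defect mu (eps : R) f g :
  qot_potentials mu mu eps f g ->
  (\int[(mu \x mu)]_z (swap_defect f g z)%:E = 0)%E.
Proof.
move=> [cf cg eps1 eps2].
have eps0 : 0 <= eps.
  rewrite -lee_fin -(eps1 0); apply: integral_ge0 => x _.
  by rewrite lee_fin slack_ge0.
pose a := slack f g; pose b := slack g f; pose w := gap_weight f g.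
have ca : continuous a by exact: slack_continuous.
have cb : continuous b by exact: slack_continuous.
have cw : continuous w by exact: gap_weight_continuous.
have a0 z : 0 <= a z := slack_ge0 f g z.
have b0 z : 0 <= b z := slack_ge0 g f z.
have w0 x : 0 <= w x := gap_weight_ge0 f g x.
have beps1 x : (\int[mu]_y (b (x, y))%:E)%E = eps%:E.
  by rewrite -(eps1 x); apply: eq_integral => y _; rewrite /b slack_sym.
have beps2 y : (\int[mu]_x (b (x, y))%:E)%E = eps%:E.
  by rewrite -(eps2 y); apply: eq_integral => x _; rewrite /b slack_sym.
set I := (\int[mu]_x (eps * w x)%:E)%E.
have a1 : (\int[(mu \x mu)]_z (a z * w z.1)%:E = I)%E.
  exact: (integral_weight1 mu mu a w eps ca a0 cw w0 eps2).
have a2 : (\int[(mu \x mu)]_z (a z * w z.2)%:E = I)%E.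
  exact: (integral_weight2 mu mu a w eps ca a0 cw w0 eps1).
have b1 : (\int[(mu \x mu)]_z (b z * w z.1)%:E = I)%E.
  exact: (integral_weight1 mu mu b w eps cb b0 cw w0 beps1).
have b2 : (\int[(mu \x mu)]_z (b z * w z.2)%:E = I)%E.
  exact: (integral_weight2 mu mu b w eps cb b0 cw w0 beps2).
have I0 : (0 <= I)%E by apply: integral_ge0 => x _; rewrite lee_fin mulr_ge0.
have Ifin : I \is a fin_num.
  rewrite ge0_fin_numE//.
  apply: (@le_lt_trans _ _ (\int[mu]_x (cst (eps * (2 * pi))%:E x))%E).
    apply: ge0_le_integral => //.
    - by move=> x _; rewrite lee_fin mulr_ge0.
    - apply/measurable_EFinP; apply: measurable_funM; first exact: measurable_cst.
      exact: continuous_measurable_rV.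
    - by move=> x _; rewrite lee_fin ler_wpM2l// gap_weight_le.
  rewrite integral_cst// -ge0_fin_numE ?fin_numM// ?fin_num_measure//.
  by rewrite mule_ge0// lee_fin !mulr_ge0// pi_ge0.
have e : (\int[(mu \x mu)]_z (swap_defect f g z)%:E + (I + I) = I + I)%E.
  rewrite -{1}b1 -{1}a2 -ge0_integralD//; last 4 first.
  - by move=> z _; rewrite lee_fin mulr_ge0.
  - exact: measurable_weight1.
  - by move=> z _; rewrite lee_fin mulr_ge0.
  - exact: measurable_weight2.
  rewrite -ge0_integralD//; last 4 first.
  - by move=> z _; rewrite lee_fin swap_defect_ge0.
  - apply/measurable_EFinP; apply: continuous_measurable_prod.
    exact: swap_defect_continuous.
  - by move=> z _; rewrite -EFinD lee_fin addr_ge0// mulr_ge0.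
  - by apply: emeasurable_funD; [exact: measurable_weight1|exact: measurable_weight2].
  rewrite -{1}a1 -{1}b2 -ge0_integralD//; last 4 first.
  - by move=> z _; rewrite lee_fin mulr_ge0.
  - exact: measurable_weight1.
  - by move=> z _; rewrite lee_fin mulr_ge0.
  - exact: measurable_weight2.
  apply: eq_integral => z _; rewrite -!EFinD; congr EFin.
  by rewrite /swap_defect -/w /a /b; ring.
have IIfin : (I + I)%E \is a fin_num by rewrite fin_numD Ifin.
by rewrite -[LHS](@addeK _ (I + I)%E)// e subee.
Qed.

Lemma slack_symmetric mu (eps : R) f g x y :
  qot_potentials mu mu eps f g -> spt mu x -> spt mu y ->
  slack f g (x, y) = slack g f (x, y).
Proof.
move=> pot mux muy; have [cf cg _ _] := pot.
have null : (mu \x mu)%E [set z | swap_defect f g z != 0] = 0%E.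
  apply: (integral0_null (mu \x mu)%E).
  - exact: swap_defect_continuous.
  - exact: swap_defect_ge0.
  - exact: (integral_swap_defect mu eps f g pot).
apply: swap_defect_eq0; apply/eqP/negPn/negP => xy0.
have oD : open [set z | swap_defect f g z != 0].
  apply: (@open_comp _ _ (swap_defect f g) [set t | t != 0]); last exact: open_neq.
  by move=> z _; exact: swap_defect_continuous.
have xy : spt (mu \x mu)%E (x, y) by rewrite spt_product.
by have := xy _ oD xy0; rewrite null ltxx.
Qed.

Definition mean f g x : R := (f x + g x) / 2.

(** Where the two slacks agree, they are either both zero, or equal to the
    positive part of the average of their arguments. *)
Lemma slack_mean mu (eps : R) f g x y :
  qot_potentials mu mu eps f g -> spt mu x -> spt mu y ->
  slack (mean f g) (mean f g) (x, y) = slack f g (x, y).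
Proof.
move=> pot mux muy; have := slack_symmetric mu eps f g x y pot mux muy.
rewrite /slack/= /mean; set c := cost _.
rewrite (_ : (f x + g x) / 2 + (f y + g y) / 2 - c =
  ((f x + g y - c) + (g x + f y - c)) / 2); last by field.
move: (f x + g y - c) (g x + f y - c) => a b.
by case: (leP 0 a); case: (leP 0 b); case: (leP 0 ((a + b) / 2)); lra.
Qed.

End symmetrization.

(** * The peak of a symmetric potential *)

Section peak.
Context {R : realType} {d : nat}.
Local Notation E := 'rV[R]_d.
Context (mu : probability E R).
Local Notation K := (spt mu).

Lemma spt_measure1 : mu K = 1%E.
Proof.
have mK : measurable K.
  rewrite -[K]setCK; apply: measurableC; apply: open_measurable_rV.
  by rewrite openC; exact: spt_closed.
have := probability_setC mu mK; rewrite spt_complement_null => /eqP.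
by rewrite eq_sym sube_eq// add0e => /eqP.
Qed.

Lemma spt_nonempty : K !=set0.
Proof.
apply/set0P/eqP => K0; have := spt_measure1.
by rewrite K0 measure0 => /eqP; rewrite eqe eq_sym oner_eq0.
Qed.

(** The complement of the support is null, so a pointwise comparison on the
    support suffices. *)
Lemma le_integral_spt (F G : E -> R) :
  measurable_fun [set: E] (fun x => (F x)%:E) ->
  measurable_fun [set: E] (fun x => (G x)%:E) ->
  (forall x, 0 <= F x) -> (forall x, 0 <= G x) ->
  (forall x, K x -> F x <= G x) ->
  (\int[mu]_x (F x)%:E <= \int[mu]_x (G x)%:E)%E.
Proof.
move=> mF mG F0 G0 FG; apply: ae_ge0_le_integral => //.
- by move=> x _; rewrite lee_fin.
- by move=> x _; rewrite lee_fin.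
exists (~` K); split.
- by apply: open_measurable_rV; rewrite openC; exact: spt_closed.
- exact: spt_complement_null.
- by apply: subsetC => x Kx _; rewrite lee_fin; exact: FG.
Qed.

Context (eps : R) (h : E -> R) (x0 : E)
  (K1 : K `<=` eball 0 1) (eps0 : 0 < eps) (ch : continuous h)
  (marg : forall y, K y -> (\int[mu]_x (slack h h (x, y))%:E)%E = eps%:E)
  (Kx0 : K x0) (hmax : forall x, K x -> h x <= h x0).
Let M := h x0.

Let mslack y : measurable_fun [set: E] (fun x => (slack h h (x, y))%:E).
Proof. by apply: measurable_section2; exact: slack_continuous. Qed.

(** If the maximum were not positive, the slack would vanish on the support,
    against the positive marginal integral. *)
Lemma peak_gt0 : 0 < M.
Proof.
rewrite ltNge; apply/negP => M0.
have : (\int[mu]_x (slack h h (x, x0))%:E <= \int[mu]_x (cst 0 x)%:E)%E.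
  apply: le_integral_spt.
  - exact: mslack.
  - by apply/measurable_EFinP; exact: measurable_cst.
  - by move=> x; exact: slack_ge0.
  - by [].
  move=> x Kx; rewrite /slack/= ge_max lexx/=.
  by have := hmax x Kx; have := cost_ge0 (x, x0); rewrite -/M; lra.
by rewrite marg// integral0 lee_fin leNgt eps0.
Qed.

(** Otherwise the slack at [y] would be at most a fixed fraction [lam < 1] of
    the slack at [x0], while both have the same integral [eps]. *)
Lemma peak_half y : K y -> enorm (y - x0) ^+ 2 < M / 25 -> M / 2 <= h y.
Proof.
move=> Ky yx0; rewrite leNgt; apply/negP => hy.
have M0 := peak_gt0.
(* As the slack at [x0] is at most [2 * M], lowering it by [eta] scales it
   down at least by the factor [lam]. *)
pose eta := M / 2 - h y; pose lam := 2 * M / (2 * M + eta).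
have eta0 : 0 < eta by rewrite subr_gt0.
have D0 : 0 < 2 * M + eta by lra.
have lam0 : 0 <= lam by rewrite divr_ge0//; lra.
have lam1 : lam < 1 by rewrite ltr_pdivrMr//; lra.
suff : (\int[mu]_x (slack h h (x, y))%:E
        <= \int[mu]_x (lam * slack h h (x, x0))%:E)%E.
  under [leRHS]eq_integral do rewrite EFinM.
  rewrite (ge0_integralZl _ _ (mslack x0)) ?lee_fin//; last first.
    by move=> x _; rewrite lee_fin slack_ge0.
  rewrite !marg// -EFinM lee_fin leNgt.
  by rewrite gtr_pMl// lam1.
apply: le_integral_spt.
- exact: mslack.
- apply/measurable_EFinP; apply: measurable_funM => //.
  by apply/measurable_EFinP; exact: mslack.
- by move=> x; exact: slack_ge0.
- by move=> x; rewrite mulr_ge0// slack_ge0.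
move=> x Kx; rewrite {1}/slack/= ge_max mulr_ge0 ?slack_ge0//=.
have [A0|A0] := leP (h x + h y - cost (x, y)) 0.
  by apply: le_trans A0 _; rewrite mulr_ge0// slack_ge0.
have hx : h x <= M := hmax x Kx.
(* The weight 1/10 makes the change of cost at most
   (1/20) 3 M + (11/2) (M / 25) = 37/100 M, below the allowed M / 2. *)
have tri := @enorm_sqr_triangle R d 10^-1 x y x0 ltac:(by rewrite invr_gt0).
have key : h x + h y - cost (x, y) + eta <= h x + M - cost (x, x0).
  move: A0 tri yx0 hx; rewrite /eta /cost/= -/M invrK.
  by move: (enorm (x - y) ^+ 2) (enorm (x - x0) ^+ 2) (enorm (y - x0) ^+ 2) => a b c; lra.
rewrite /slack/= -/M max_r; last by lra.
rewrite /lam mulrAC ler_pdivlMr//.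
have c0 := cost_ge0 (x, x0).
set X := h x + M - _ in key *; set A := h x + h y - _ in key *.
have XM : X <= 2 * M by rewrite /X; lra.
rewrite -subr_ge0.
have -> : 2 * M * X - A * (2 * M + eta) =
  (X - eta - A) * (2 * M + eta) + eta * (2 * M + eta - X) by ring.
by rewrite addr_ge0// mulr_ge0//; lra.
Qed.

(** On this ball [h] is at least [M / 2] and the cost to [x0] at most
    [M / 50], so the slack at [x0] is at least [M]. *)
Lemma peak_ball_mass (r : R) : 0 < r -> r <= M / 25 ->
  (M%:E * mu (eball x0 (Num.sqrt r)) <= eps%:E)%E.
Proof.
move=> r0 rM; have M0 := peak_gt0.
have mB : measurable (eball x0 (Num.sqrt r)).
  by apply: open_measurable_rV; exact: eball_open.
have -> : (M%:E * mu (eball x0 (Num.sqrt r)) =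
    \int[mu]_x (M * \1_(eball x0 (Num.sqrt r)) x)%:E)%E.
  under eq_integral do rewrite EFinM.
  have mI : measurable_fun [set: E] (fun x => (\1_(eball x0 (Num.sqrt r)) x : R)%:E).
    by apply/measurable_EFinP; exact: measurable_indic.
  rewrite (ge0_integralZl _ _ mI) ?lee_fin// ?(ltW M0)//.
  by rewrite integral_indic// setIT.
rewrite -(marg x0 Kx0); apply: le_integral_spt.
- by apply/measurable_EFinP; apply: measurable_funM => //; exact: measurable_indic.
- exact: mslack.
- by move=> x; rewrite mulr_ge0// ltW.
- by move=> x; exact: slack_ge0.
move=> x Kx; rewrite indicE; case: (boolP (x \in _)) => [|_]; last first.
  by rewrite mulr0 slack_ge0.
rewrite inE /eball/= enorm_ltE ?sqrtr_ge0// (sqr_sqrtr (ltW r0)).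
move=> xr; rewrite mulr1.
have half := peak_half x Kx (lt_le_trans xr rM).
have active : M <= h x + M - cost (x, x0) by rewrite /cost/=; lra.
by rewrite /slack/= -/M le_max active orbT.
Qed.

(** The support has diameter at most [2]. *)
Lemma rho_large_radius_ge1 (r : R) : 4 < r -> (1 <= rho mu (Num.sqrt r))%E.
Proof.
move=> r4; apply: le_ereal_inf_tmp => _ [x Kx <-].
rewrite -spt_measure1; apply: le_measure; rewrite ?inE.
- rewrite -[K]setCK; apply: measurableC; apply: open_measurable_rV.
  by rewrite openC; exact: spt_closed.
- by apply: open_measurable_rV; exact: eball_open.
move=> y Ky; rewrite /eball/=.
apply: le_lt_trans (unit_ball_diameter _ _ (K1 y Ky) (K1 x Kx)) _.
by rewrite -(@ltr_pXn2r _ 2%N)// ?nnegrE ?sqrtr_ge0// sqr_sqrtr; lra.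
Qed.

(** A radius [r < M / 25] with [eps < r * rho (sqrt r)] would contradict
    [peak_ball_mass], as [r <= M].  Large radii make the set defining
    [delta_ST] nonempty, so that its infimum is a genuine one. *)
Lemma peak_le_delta : M / 25 <= delta_ST mu eps.
Proof.
apply: lb_le_inf.
  exists (5 + eps); split; first by rewrite addr_gt0.
  apply: (@lt_le_trans _ _ ((5 + eps)%:E * 1)%E).
    by rewrite mule1 lte_fin; lra.
  apply: lee_wpmul2l; first by rewrite lee_fin addr_ge0// ltW.
  by apply: rho_large_radius_ge1; rewrite (@lt_trans _ _ 5) ?ltr_nat ?ltrDl.
move=> r [r0 rr]; rewrite leNgt; apply/negP => rM.
have M0 := peak_gt0.
suff : (eps%:E < eps%:E)%E by rewrite ltxx.
apply: (lt_le_trans rr); apply: le_trans (peak_ball_mass r r0 (ltW rM)).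
apply: (@le_trans _ _ (r%:E * mu (eball x0 (Num.sqrt r)))%E).
  apply: lee_wpmul2l; first by rewrite lee_fin ltW.
  by apply: ereal_inf_lbound; exists x0.
by apply: lee_wpmul2r; [exact: measure_ge0|rewrite lee_fin; lra].
Qed.

End peak.

(** * Supports of the couplings *)

Section support.
Context {R : realType} {d : nat}.
Local Notation E := 'rV[R]_d.
Implicit Types (mu : probability E R) (eps : R) (f g : E -> R).

Lemma mean_continuous f g : continuous f -> continuous g -> continuous (mean f g).
Proof.
move=> cf cg x.
apply: (@continuousM _ _ (fun x => f x + g x) (cst 2^-1)); last exact: cst_continuous.
by apply: (@continuousD _ _ _ f g); [exact: cf|exact: cg].
Qed.

(** The marginal equation passes to [mean f g], but only at points of the
    support, where the slacks are known to agree. *)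
Lemma mean_marginal mu eps f g y : qot_potentials mu mu eps f g -> spt mu y ->
  (\int[mu]_x (slack (mean f g) (mean f g) (x, y))%:E)%E = eps%:E.
Proof.
move=> pot muy; have [cf cg eps1 _] := pot; rewrite -(eps1 y).
have cm := mean_continuous f g cf cg.
have mm : measurable_fun [set: E] (fun x => (slack (mean f g) (mean f g) (x, y))%:E).
  by apply: measurable_section2; exact: slack_continuous.
have mfg : measurable_fun [set: E] (fun x => (slack f g (x, y))%:E).
  by apply: measurable_section2; exact: slack_continuous.
apply/eqP; rewrite eq_le; apply/andP; split;
  apply: le_integral_spt => // x; first [exact: slack_ge0|move=> mux];
  by rewrite (slack_mean mu eps f g x y pot mux muy).
Qed.

Lemma active_pair_bound mu eps f g (x y : E) :
  spt mu `<=` eball 0 1 -> 0 < eps -> qot_potentials mu mu eps f g ->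
  spt mu x -> spt mu y -> cost (x, y) < f x + g y ->
  enorm (x - y) <= 10 * Num.sqrt (delta_ST mu eps).
Proof.
move=> K1 eps0 pot mux muy xy; have [cf cg _ _] := pot.
have cm := mean_continuous f g cf cg.
have Kcompact : compact (spt mu).
  by apply: subset_unit_ball_compact => //; exact: spt_closed.
have [x0 /set_mem Kx0 hmax] :=
  compact_EVT_max (spt_nonempty mu) Kcompact (continuous_subspaceT cm).
have {}hmax z : spt mu z -> mean f g z <= mean f g x0.
  by move=> Kz; apply: hmax; rewrite inE.
have marg z (Kz : spt mu z) := mean_marginal mu eps f g z pot Kz.
have M0 := peak_gt0 mu eps (mean f g) x0 eps0 cm marg Kx0 hmax.
have Md := peak_le_delta mu eps (mean f g) x0 K1 eps0 cm marg Kx0 hmax.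
set M := mean f g x0 in M0 Md hmax.
have le2M : cost (x, y) <= 2 * M.
  have := slack_mean mu eps f g x y pot mux muy.
  rewrite /slack/= (max_r (x := 0) (y := f x + g y - _)); last lra.
  have hx := hmax x mux; have hy := hmax y muy.
  by case: (leP 0 (mean f g x + mean f g y - cost (x, y))) => _ ?; lra.
rewrite -(@ler_pXn2r _ 2%N)// ?nnegrE ?enorm_ge0//.
have delta0 : 0 <= delta_ST mu eps by lra.
rewrite exprMn (sqr_sqrtr delta0).
by move: le2M; rewrite /cost/=; lra.
Qed.

Lemma spt_qot_in_spt mu f g (z : E * E) :
  spt_qot mu mu f g z -> spt mu z.1 /\ spt mu z.2.
Proof.
have cl1 : closed (fst @^-1` spt mu : set (E * E)).
  by apply: closed_comp => [p _|]; [exact: cvg_fst|exact: spt_closed].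
have cl2 : closed (snd @^-1` spt mu : set (E * E)).
  by apply: closed_comp => [p _|]; [exact: cvg_snd|exact: spt_closed].
move=> zS; split; [apply: cl1|apply: cl2];
  by apply: closure_subset zS => p /=; rewrite spt_product => -[[]].
Qed.

Lemma spt_qot_bound mu eps f g (z : E * E) :
  spt mu `<=` eball 0 1 -> 0 < eps -> qot_potentials mu mu eps f g ->
  spt_qot mu mu f g z -> enorm (z.1 - z.2) <= 10 * ub_rate mu eps.
Proof.
move=> K1 eps0 pot.
have cl : closed [set z : E * E | enorm (z.1 - z.2) <= 10 * ub_rate mu eps].
  apply: (@closed_comp _ _ (fun z : E * E => enorm (z.1 - z.2))
    [set t | t <= 10 * ub_rate mu eps]).
    by move=> p _; exact: enormB_continuous.
  exact: closed_le.
move=> zS; apply: cl; apply: closure_subset zS => -[x y] /=.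
rewrite spt_product => -[[/= mux muy] xy].
have xyd := active_pair_bound mu eps f g x y K1 eps0 pot mux muy xy.
have xyD := ediam_ub (spt mu) x y K1 mux muy.
rewrite /ub_rate; case: (leP _ (ediam (spt mu))) => _ //.
apply: (le_trans xyD); rewrite ler_peMl ?ler1n//.
exact: le_trans (enorm_ge0 (x - y)) xyD.
Qed.

(** The image of [mu] under [x |-> (x, x)]. *)
Lemma diagonal_coupling mu : exists pi : probability (E * E)%type R,
  coupling mu mu pi /\ transport_cost pi = 0%E.
Proof.
have mdiag : measurable_fun [set: E] (fun x : E => (x, x)).
  by apply: measurable_fun_pair; exact: measurable_id.
pose X : {mfun E >-> (E * E)%type} := mfun_Sub (mem_set mdiag).
exists (distribution mu X); split.
  split=> A mA; rewrite /distribution /pushforward.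
    by congr (mu _); apply/seteqP; split=> x //= [].
  by congr (mu _); apply/seteqP; split=> x //= [].
rewrite /transport_cost ge0_integral_pushforward//=.
- by rewrite integral0_eq// => x _; congr EFin; exact: cost_diag.
- by apply/measurable_EFinP; apply: continuous_measurable_prod; exact: cost_continuous.
- by move=> z _; rewrite lee_fin cost_ge0.
Qed.

(** A neighbourhood [U] of [(x, x)] contains, up to a set where the cost is
    nonzero, the strip [V * setT] with [V] the trace of [U] on the diagonal; that
    set is null for an optimal plan and the strip has mass [mu V > 0]. *)
Lemma diagonal_in_spt_ot mu (pi : probability (E * E)%type R) x :
  ot_plan mu mu pi -> spt mu x -> spt pi (x, x).
Proof.
move=> [[pi1 _] pi_min] mux U oU Uxx.
have [pi0 [/pi_min + cost0]] := diagonal_coupling mu.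
rewrite cost0 => pi_le0.
have cost_pi : transport_cost pi = 0%E.
  apply/eqP; rewrite eq_le pi_le0 integral_ge0// => z _.
  by rewrite lee_fin cost_ge0.
have off := integral0_null pi (@cost R d) cost_continuous cost_ge0 cost_pi.
have offM : measurable [set z : E * E | cost z != 0].
  apply: open_measurable_prod.
  apply: (@open_comp _ _ (@cost R d) [set t | t != 0]); last exact: open_neq.
  by move=> z _; exact: cost_continuous.
pose V := (fun y : E => (y, y)) @^-1` U.
have oV : open V.
  apply: open_comp => // y _.
  exact: (@cvg_pair _ _ _ (nbhs y) (nbhs y) (nbhs y) _ _ _ id id
    (@cvg_id _ _) (@cvg_id _ _)).
have mV : measurable V by exact: open_measurable_rV.
have mU : measurable U by exact: open_measurable_prod.
apply: (lt_le_trans (mux V oV Uxx)).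
rewrite -pi1// -[leRHS]adde0 -off.
apply: le_trans (measureU2 _ _ _) => //.
rewrite le_measure ?inE//; [exact: measurableX|exact: measurableU|].
move=> [y z] /= [Vy _].
have [yz|] := eqVneq (cost (y, z)) 0; last by right.
by left; rewrite -(cost_eq0 _ _ yz).
Qed.

End support.

Theorem theorem3p1 (R : realType) :
  exists2 Cub : R, 0 < Cub &
  forall (d : nat) (mu : probability 'rV[R]_d R) (eps : R)
    (pi_eps : probability ('rV[R]_d * 'rV[R]_d)%type R) (f g : 'rV[R]_d -> R),
    (0 < d)%N ->
    standing_assumptions mu ->
    0 < eps ->
    qot_plan mu mu eps pi_eps ->
    qot_potentials mu mu eps f g ->
    qot_density mu mu eps f g pi_eps ->
    (ereal_sup [set (enorm (z.1 - z.2))%:E | z in spt_qot mu mu f g]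
       <= (Cub * ub_rate mu eps)%:E)%E /\
    (forall pi_star : probability ('rV[R]_d * 'rV[R]_d)%type R,
       ot_plan mu mu pi_star ->
       (dist (spt_qot mu mu f g) (spt pi_star)
          <= (Cub * ub_rate mu eps)%:E)%E).
Proof.
exists 10 => // d mu eps pi_eps f g _ [_ K1 _] eps0 _ pot _.
split=> [|pi_star ot].
  apply: ge_ereal_sup => _ [z zS <-]; rewrite lee_fin.
  exact: (spt_qot_bound mu eps f g z K1 eps0 pot zS).
apply: ge_ereal_sup => _ [[x y] xyS <-].
have [/= mux _] := spt_qot_in_spt mu f g _ xyS.
apply: (@le_trans _ _ (enorm2 ((x, y) - (x, x)))%:E).
  apply: ereal_inf_lbound; exists (x, x) => //.
  exact: (diagonal_in_spt_ot mu pi_star x ot mux).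
rewrite lee_fin (_ : enorm2 _ = enorm (x - y)).
  exact: (spt_qot_bound mu eps f g (x, y) K1 eps0 pot xyS).
rewrite enormB /enorm2/= subrr (_ : enorm 0 = 0).
  by rewrite expr0n/= add0r sqrtr_sqr ger0_norm ?enorm_ge0.
by rewrite /enorm big1 ?sqrtr0// => i _; rewrite mxE expr0n.
Qed.
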